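(* Let $(A,\circ)$ be an anti-pre-Lie algebra and $(l_\circ,r_\circ,V)$ a representation of $(A,\circ)$. Let $\hat A=A\ltimes_{r_\circ^*-l_\circ^*,\,r_\circ^*}V^*$ be the semi-direct product anti-pre-Lie algebra. Let $T:V\to A$ be a linear map, identified with an element of $\hat A\otimes\hat A$ through $\mathrm{Hom}(V,A)\cong A\otimes V^*\subseteq\hat A\otimes\hat A$. Then $r=T-\tau(T)$ is a skew-symmetric solution of the APL-YBE in the anti-pre-Lie algebra $\hat A$ if and only if $T$ is an $\mathcal O$-operator of $(A,\circ)$ associated to $(l_\circ,r_\circ,V)$.
   Context: All vector spaces and algebras are finite-dimensional over an algebraically closed field $\mathbb K$ of characteristic zero. Anti-pre-Lie algebra: a vector space $A$ with a bilinear operation $\circ$ such that, with $[x,y]=x\circ y-y\circ x$, for all $x,y,z$: $x\circ(y\circ z)-y\circ(x\circ z)=[y,x]\circ z$ and $[x,y]\circ z+[y,z]\circ x+[z,x]\circ y=0$. Representation $(l,r,V)$ of $(A,\circ)$: linear maps $l,r:A\to\mathrm{End}(V)$ with, for all $x,y\in A$, $l(y\circ x)-l(x\circ y)=l(x)l(y)-l(y)l(x)$; $r(x\circ y)=l(x)r(y)+r(y)l(x)-r(y)r(x)$; $l(y\circ x)-l(x\circ y)=r(x)l(y)-r(y)l(x)-r(x)r(y)+r(y)r(x)$. For a representation, the semi-direct product $A\ltimes_{l,r}V$ is the anti-pre-Lie algebra $A\oplus V$ with $(x+u)\circ(y+v)=x\circ y+l(x)v+r(y)u$. For linear $\rho:A\to\mathrm{End}(V)$,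 $\rho^*:A\to\mathrm{End}(V^* )$ is given by $\langle\rho^*(x)u^*,v\rangle=-\langle u^*,\rho(x)v\rangle$. If $(l,r,V)$ is a representation then so is $(r^*-l^*,r^*,V^* )$. With $\{v_k\}$ a basis of $V$ and $\{v_k^*\}$ its dual basis, $T$ is identified with $\sum_k T(v_k)\otimes v_k^*$. $\tau(x\otimes y)=y\otimes x$. APL-YBE in an anti-pre-Lie algebra: $r=\sum_i a_i\otimes b_i$ is a solution if $\mathbf T(r)=\sum_{i,j}\big(a_i\circ a_j\otimes b_i\otimes b_j+a_i\otimes b_i\circ a_j\otimes b_j-a_i\otimes a_j\otimes[b_i,b_j]\big)=0$; $r$ is skew-symmetric if $\tau(r)=-r$. $\mathcal O$-operator of $(A,\circ)$ associated to $(l_\circ,r_\circ,V)$: a linear map $T:V\to A$ with $T(u)\circ T(v)=T\big(l_\circ(T(u))v+r_\circ(T(v))u\big)$ for all $u,v\in V$. *)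

(* Defs.v *)
From HB Require Import structures.
From mathcomp Require Import all_boot all_order all_algebra.
From mathcomp Require Import ring.

Set Implicit Arguments.
Unset Strict Implicit.
Unset Printing Implicit Defensive.

Import GRing.Theory.
Local Open Scope ring_scope.

(* The tensor product U (x) W is realised by coordinate arrays in the library *)
(* bases vbasis {:U} and vbasis {:W}; tens_lift / tens_liftE / tens_lift_uniq *)
(* below are its universal property, so the choice of bases is immaterial.    *)
Section Tensor.
Variables (K : fieldType) (U W : vectType K).

Definition tens := 'M[K]_(\dim {:U}, \dim {:W}).
HB.instance Definition _ :=
  Vector.copy tens 'M[K]_(\dim {:U}, \dim {:W}).

Definition tpure (u : U) (w : W) : tens :=
  \matrix_(i, j) (coord (vbasis {:U}) i u * coord (vbasis {:W}) j w).

Definition tens_lift (X : lmodType K) (f : U -> W -> X) (t : tens) : X :=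
  \sum_i \sum_j t i j *: f (vbasis {:U})`_i (vbasis {:W})`_j.

End Tensor.

Arguments tens {K} U W.

Notation "u '\ox' w" := (tpure u w) (at level 40, left associativity).

Definition tswap (K : fieldType) (U W : vectType K) : tens U W -> tens W U :=
  tens_lift (fun u w => w \ox u).

Section TensorTheory.
Variable K : fieldType.

Lemma tpure_is_bilinear (U W : vectType K) :
  bilinear_for *:%R *:%R (@tpure K U W).
Proof.
split=> [w|u] a x y; apply/matrixP=> i j; rewrite !mxE linearP /=.
  by rewrite mulrDl mulrA.
by rewrite mulrDr mulrCA.
Qed.
HB.instance Definition _ (U W : vectType K) :=
  bilinear_isBilinear.Build K U W (tens U W) *:%R *:%R (@tpure K U W)
    (@tpure_is_bilinear U W).

Lemma tens_lift_is_linear (U W : vectType K) (X : lmodType K)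
  (f : U -> W -> X) : linear (tens_lift f).
Proof.
move=> a s t; rewrite /tens_lift scaler_sumr -big_split /=.
apply: eq_bigr => i _; rewrite scaler_sumr -big_split /=.
by apply: eq_bigr => j _; rewrite !mxE scalerDl scalerA.
Qed.
HB.instance Definition _ (U W : vectType K) (X : lmodType K)
    (f : U -> W -> X) :=
  GRing.isLinear.Build K (tens U W) X *:%R (tens_lift f)
    (tens_lift_is_linear f).

Lemma tens_liftE (U W : vectType K) (X : lmodType K)
    (f : {bilinear U -> W -> X}) u w :
  tens_lift f (u \ox w) = f u w.
Proof.
rewrite [u in RHS](coord_vbasis (memvf u)) linear_sumlz /=.
apply: eq_bigr => i _.
rewrite linearZl_LR [w in RHS](coord_vbasis (memvf w)) linear_sumr scaler_sumr.
by apply: eq_bigr => j _; rewrite linearZr_LR scalerA mxE.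
Qed.

Lemma tens_lift_pure (U W : vectType K) (X : lmodType K) (f : U -> W -> X) :
  bilinear_for *:%R *:%R f -> forall u w, tens_lift f (u \ox w) = f u w.
Proof.
move=> f_bilin u w.
pose B := bilinear_isBilinear.Build K U W X *:%R *:%R f f_bilin.
pose F : {bilinear U -> W -> X} := HB.pack f B.
exact: (tens_liftE F).
Qed.

Lemma tens_decomp (U W : vectType K) (t : tens U W) :
  t = \sum_i \sum_j t i j *: ((vbasis {:U})`_i \ox (vbasis {:W})`_j).
Proof.
apply/matrixP=> i j; rewrite summxE (bigD1 i) //= summxE (bigD1 j) //= !mxE.
rewrite !coord_free ?(basis_free (vbasisP _)) // !eqxx !mulr1.
rewrite !big1 ?addr0 // => [i' /negPf ni|j' /negPf nj].
  rewrite summxE big1 // => j' _.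
  by rewrite !mxE coord_free ?(basis_free (vbasisP _)) // ni mul0r mulr0.
rewrite !mxE !coord_free ?(basis_free (vbasisP _)) //.
by rewrite eqxx nj !mulr0.
Qed.

Lemma tens_lift_uniq (U W : vectType K) (X : lmodType K)
    (g h : {linear tens U W -> X}) :
  (forall u w, g (u \ox w) = h (u \ox w)) -> g =1 h.
Proof.
move=> gh t; rewrite (tens_decomp t) !linear_sum; apply: eq_bigr => i _.
by rewrite !linear_sum; apply: eq_bigr => j _; rewrite !linearZ gh.
Qed.

Lemma tswap_pure (U W : vectType K) (u : U) (w : W) :
  tswap (u \ox w) = w \ox u.
Proof.
rewrite /tswap /tens_lift.
rewrite [u in RHS](coord_vbasis (memvf u)) linear_sumr /=.
apply: eq_bigr => i _.
rewrite linearZr_LR /= [w in RHS](coord_vbasis (memvf w)) linear_sumlz /=.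
rewrite scaler_sumr.
by apply: eq_bigr => j _; rewrite linearZl_LR scalerA mxE.
Qed.

End TensorTheory.

Record antiPreLie (K : fieldType) (A : vectType K) := AntiPreLie {
  apl_mul : {bilinear A -> A -> A};
  apl_comm := fun x y => apl_mul x y - apl_mul y x;
  apl_left : forall x y z,
    apl_mul x (apl_mul y z) - apl_mul y (apl_mul x z)
      = apl_mul (apl_comm y x) z;
  apl_cyclic : forall x y z,
    apl_mul (apl_comm x y) z + apl_mul (apl_comm y z) x
      + apl_mul (apl_comm z x) y = 0
}.

Record aplRep (K : fieldType) (A : vectType K) (P : antiPreLie A)
    (V : vectType K) := AplRep {
  rep_l : A -> 'End(V);
  rep_r : A -> 'End(V);
  rep_l_linear : linear rep_l;
  rep_r_linear : linear rep_r;
  rep_ax1 : forall x y,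
    rep_l (apl_mul P y x) - rep_l (apl_mul P x y)
      = (rep_l x \o rep_l y)%VF - (rep_l y \o rep_l x)%VF;
  rep_ax2 : forall x y,
    rep_r (apl_mul P x y)
      = (rep_l x \o rep_r y)%VF + (rep_r y \o rep_l x)%VF
        - (rep_r y \o rep_r x)%VF;
  rep_ax3 : forall x y,
    rep_l (apl_mul P y x) - rep_l (apl_mul P x y)
      = (rep_r x \o rep_l y)%VF - (rep_r y \o rep_l x)%VF
        - (rep_r x \o rep_r y)%VF + (rep_r y \o rep_r x)%VF
}.

Definition dual (K : fieldType) (V : vectType K) := 'Hom(V, K^o).
HB.instance Definition _ (K : fieldType) (V : vectType K) :=
  Vector.copy (dual V) 'Hom(V, K^o).

Arguments dual {K} V.

Section DualBasis.
Variables (K : fieldType) (V : vectType K).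

Definition dual_basis (n : nat) (b : n.-tuple V) (k : 'I_n) : dual V :=
  linfun (coord b k : V -> K^o).

Lemma dual_basisE n (b : n.-tuple V) k v : dual_basis b k v = coord b k v.
Proof.
have lin : linear (coord b k : V -> K^o) by move=> a x y; rewrite linearP.
pose L := GRing.isLinear.Build K _ _ _ _ lin.
pose F : {linear V -> K^o} := HB.pack (coord b k : V -> K^o) L.
by rewrite /dual_basis -[X in linfun X]/(F : _ -> _) lfunE.
Qed.

Lemma dual_sep (v w : V) : (forall f : dual V, f v = f w) -> v = w.
Proof.
move=> fE; rewrite (coord_vbasis (memvf v)) (coord_vbasis (memvf w)).
by apply: eq_bigr => k _; rewrite -!dual_basisE fE.
Qed.

Lemma dualP (f g : dual V) : (forall v, f v = g v) -> f = g.
Proof. by move=> fg; apply/lfunP. Qed.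

Lemma dualD (f g : dual V) v : (f + g) v = f v + g v :> K.
Proof. exact: (add_lfunE (f : 'Hom(V, K^o)) g v). Qed.
Lemma dualN (f : dual V) v : (- f) v = - f v :> K.
Proof. exact: (opp_lfunE (f : 'Hom(V, K^o)) v). Qed.
Lemma dualZ a (f : dual V) v : (a *: f) v = a * f v :> K.
Proof. exact: (scale_lfunE a (f : 'Hom(V, K^o)) v). Qed.
Lemma dual_sum (I : Type) (s : seq I) (f : I -> dual V) v :
  (\sum_(i <- s) f i) v = \sum_(i <- s) f i v :> K.
Proof.
apply: (big_morph (fun g : dual V => g v : K)) => [g h|]; first exact: dualD.
by rewrite -(scale0r (0 : dual V)) dualZ mul0r.
Qed.
Lemma dual_add (f : dual V) v w : f (v + w) = f v + f w :> K.
Proof. exact: (linearD (f : 'Hom(V, K^o)) v w). Qed.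
Lemma dual_sub (f : dual V) v w : f (v - w) = f v - f w :> K.
Proof. exact: (linearB (f : 'Hom(V, K^o)) v w). Qed.
Lemma dual_opp (f : dual V) v : f (- v) = - f v :> K.
Proof. exact: (linearN (f : 'Hom(V, K^o)) v). Qed.
Lemma dual_zero (f : dual V) : f 0 = 0 :> K.
Proof. exact: (linear0 (f : 'Hom(V, K^o))). Qed.
Lemma dual_scale (f : dual V) a v : f (a *: v) = a * f v :> K.
Proof. exact: (linearZ_LR (f : 'Hom(V, K^o)) a v). Qed.

End DualBasis.

(* rho^*, characterised by <rho^*(x) u, v> = - <u, rho(x) v> (dual_mapE). *)
Definition dual_map (K : fieldType) (A V : vectType K) (rho : A -> 'End(V))
  (x : A) : 'End(dual V) := linfun (fun u : dual V => - (u \o rho x)%VF).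

Section DualRep.
Variables (K : fieldType) (A V : vectType K).

Lemma dual_mapE (rho : A -> 'End(V)) x (u : dual V) v :
  dual_map rho x u v = - u (rho x v).
Proof.
have lin : linear (fun u : dual V => - (u \o rho x)%VF : dual V).
  move=> a f g; apply: dualP => w.
  rewrite !(dualD, dualN, dualZ, comp_lfunE).
  by ring.
pose L := GRing.isLinear.Build K _ _ _ _ lin.
pose F : {linear dual V -> dual V} :=
  HB.pack (fun u : dual V => - (u \o rho x)%VF : dual V) L.
rewrite /dual_map -[X in linfun X]/(F : _ -> _) lfunE /= dualN.
by rewrite comp_lfunE.
Qed.

Lemma dual_map_linear (rho : A -> 'End(V)) :
  linear rho -> linear (dual_map rho).
Proof.
move=> rho_lin a x y; apply/lfunP=> u; apply: dualP => v.
rewrite add_lfunE scale_lfunE dualD dualZ !dual_mapE rho_lin.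
rewrite add_lfunE scale_lfunE dual_add dual_scale.
by ring.
Qed.

End DualRep.

Section DualRepresentation.
Variables (K : fieldType) (A V : vectType K) (P : antiPreLie A).
Variable M : aplRep P V.

Definition dual_l (x : A) : 'End(dual V) :=
  dual_map (rep_r M) x - dual_map (rep_l M) x.
Definition dual_r (x : A) : 'End(dual V) := dual_map (rep_r M) x.

Lemma dual_lE x (u : dual V) v :
  dual_l x u v = u (rep_l M x v) - u (rep_r M x v).
Proof.
rewrite /dual_l add_lfunE opp_lfunE dualD dualN !dual_mapE.
by ring.
Qed.

Lemma dual_rE x (u : dual V) v : dual_r x u v = - u (rep_r M x v).
Proof. exact: dual_mapE. Qed.

Let lfE := (add_lfunE, opp_lfunE, comp_lfunE).

Lemma rep_ax2E x y (u : dual V) v : u (rep_r M (apl_mul P x y) v)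
  = u (rep_l M x (rep_r M y v)) + u (rep_r M y (rep_l M x v))
    - u (rep_r M y (rep_r M x v)).
Proof. by rewrite rep_ax2 !lfE linearB linearD. Qed.
Lemma rep_ax3E x y (u : dual V) v :
  u (rep_l M (apl_mul P y x) v) = u (rep_l M (apl_mul P x y) v)
    + (u (rep_r M x (rep_l M y v)) - u (rep_r M y (rep_l M x v))
    - u (rep_r M x (rep_r M y v)) + u (rep_r M y (rep_r M x v))).
Proof.
move/lfunP: (rep_ax3 M x y) => /(_ v); rewrite !lfE => /(canRL (subrK _)) ->.
by rewrite linearD addrC; congr (_ + _); rewrite linearD !linearB.
Qed.
Lemma rep_ax1E x y (u : dual V) v :
  u (rep_l M x (rep_l M y v)) = u (rep_l M y (rep_l M x v))
    + (u (rep_l M (apl_mul P y x) v) - u (rep_l M (apl_mul P x y) v)).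
Proof.
move/lfunP: (rep_ax1 M x y) => /(_ v); rewrite !lfE => E.
by rewrite -linearB E linearB addrC subrK.
Qed.

Fact dual_l_linear : linear dual_l.
Proof.
move: dual_l dual_lE => dl dlE a x y; apply/lfunP=> u; apply: dualP => v.
rewrite add_lfunE scale_lfunE dualD dualZ !dlE rep_l_linear rep_r_linear.
rewrite !(add_lfunE, scale_lfunE) !(dual_add, dual_scale).
by ring.
Qed.

Fact dual_r_linear : linear dual_r.
Proof. exact/dual_map_linear/rep_r_linear. Qed.

Fact dual_ax1 x y :
  dual_l (apl_mul P y x) - dual_l (apl_mul P x y)
    = (dual_l x \o dual_l y)%VF - (dual_l y \o dual_l x)%VF.
Proof.
move: dual_l dual_lE => dl dlE.
apply/lfunP=> u; apply/lfunP=> v.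
rewrite !lfE !dlE !rep_ax2E (rep_ax1E x y) !(rep_ax3E x y).
by ring.
Qed.

Fact dual_ax2 x y :
  dual_r (apl_mul P x y)
    = (dual_l x \o dual_r y)%VF + (dual_r y \o dual_l x)%VF
      - (dual_r y \o dual_r x)%VF.
Proof.
move: dual_l dual_r dual_lE dual_rE => dl dr dlE drE.
apply/lfunP=> u; apply/lfunP=> v.
rewrite !lfE !(dlE, drE) rep_ax2E.
by ring.
Qed.

Fact dual_ax3 x y :
  dual_l (apl_mul P y x) - dual_l (apl_mul P x y)
    = (dual_r x \o dual_l y)%VF - (dual_r y \o dual_l x)%VF
      - (dual_r x \o dual_r y)%VF + (dual_r y \o dual_r x)%VF.
Proof.
move: dual_l dual_r dual_lE dual_rE => dl dr dlE drE.
apply/lfunP=> u; apply/lfunP=> v.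
rewrite !lfE !(dlE, drE) !rep_ax2E !(rep_ax3E x y).
by ring.
Qed.

(* The representation (r^* - l^*, r^*, V^* ). *)
Definition dualRep : aplRep P (dual V) :=
  AplRep dual_l_linear dual_r_linear dual_ax1 dual_ax2 dual_ax3.

End DualRepresentation.

Section SemiDirect.
Variables (K : fieldType) (A V : vectType K) (P : antiPreLie A).
Variable M : aplRep P V.

Definition sd_mul (a b : A * V) : A * V :=
  (apl_mul P a.1 b.1, rep_l M a.1 b.2 + rep_r M b.1 a.2).

Fact sd_mul_is_bilinear : bilinear_for *:%R *:%R sd_mul.
Proof.
have scaleDACA (k : K) (p q p' q' : V) :
    k *: p + p' + (k *: q + q') = k *: (p + q) + (p' + q').
  by rewrite scalerDr addrACA.
split=> [b|a] k x y; rewrite /sd_mul /=; congr (_, _).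
- by rewrite linearPl.
- by rewrite rep_l_linear add_lfunE scale_lfunE linearP scaleDACA.
- by rewrite linearPr.
- by rewrite linearP rep_r_linear add_lfunE scale_lfunE scaleDACA.
Qed.
HB.instance Definition _ :=
  bilinear_isBilinear.Build K (A * V)%type (A * V)%type (A * V)%type
    *:%R *:%R sd_mul sd_mul_is_bilinear.

Let comm (x y : A * V) := sd_mul x y - sd_mul y x.

Let lD x := linearD (rep_l M x).
Let rD x := linearD (rep_r M x).
Let lB x := linearB (rep_l M x).
Let rB x := linearB (rep_r M x).
Let lBl x y v : rep_l M (x - y) v = rep_l M x v - rep_l M y v.
Proof.
by rewrite (zmod_morphism_linear (rep_l_linear M)) add_lfunE opp_lfunE.
Qed.
Let rBl x y v : rep_r M (x - y) v = rep_r M x v - rep_r M y v.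
Proof.
by rewrite (zmod_morphism_linear (rep_r_linear M)) add_lfunE opp_lfunE.
Qed.
Let rN x := linearN (rep_r M x).
Let sdE := (lBl, rBl, lD, rD, lB, rB, dual_sub, dual_add).

Fact sd_left x y z :
  sd_mul x (sd_mul y z) - sd_mul y (sd_mul x z) = sd_mul (comm y x) z.
Proof.
case: x y z => [x u] [y v] [z w].
apply/pair_equal_spec; split; rewrite /=; first exact: apl_left.
apply: dual_sep => f; rewrite !sdE !rep_ax2E (rep_ax1E M x y).
by ring.
Qed.

Fact sd_cyclic x y z :
  sd_mul (comm x y) z + sd_mul (comm y z) x + sd_mul (comm z x) y = 0.
Proof.
case: x y z => [x u] [y v] [z w].
apply/pair_equal_spec; split; rewrite /=; first exact: apl_cyclic.
apply: dual_sep => f; rewrite !sdE !rN !dual_opp !sdE dual_zero.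
rewrite (rep_ax3E M x y) (rep_ax3E M y z) (rep_ax3E M z x).
by ring.
Qed.

Definition semidirect : antiPreLie (A * V)%type :=
  AntiPreLie sd_left sd_cyclic.

End SemiDirect.

Section APLYBE.
Variables (K : fieldType) (A : vectType K) (P : antiPreLie A).

Definition aplT_term (a b a' b' : A) : tens (tens A A) A :=
  apl_mul P a a' \ox b \ox b' + a \ox apl_mul P b a' \ox b'
    - a \ox a' \ox apl_comm P b b'.

(* For r = sum_i a_i (x) b_i this is sum_{i,j} aplT_term a_i b_i a_j b_j;     *)
(* see aplT_sum.                                                              *)
Definition aplT (r : tens A A) : tens (tens A A) A :=
  tens_lift (fun a b => tens_lift (aplT_term a b) r) r.

Let tlP (U W : vectType K) (w : W) k (u v : U) :
  (k *: u + v) \ox w = k *: (u \ox w) + v \ox w.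
Proof. exact: linearPl. Qed.
Let trP (U W : vectType K) (w : U) k (u v : W) :
  w \ox (k *: u + v) = k *: (w \ox u) + w \ox v.
Proof. exact: linearPr. Qed.

Let commPl k x y z :
  apl_comm P (k *: x + y) z = k *: apl_comm P x z + apl_comm P y z.
Proof. by rewrite /apl_comm linearPl linearPr scalerBr opprD addrACA. Qed.
Let commPr k x y z :
  apl_comm P z (k *: x + y) = k *: apl_comm P z x + apl_comm P z y.
Proof. by rewrite /apl_comm linearPl linearPr scalerBr opprD addrACA. Qed.

Let sum3P (X : lmodType K) k (x y z x' y' z' : X) :
  k *: x + x' + (k *: y + y') - (k *: z + z')
    = k *: (x + y - z) + (x' + y' - z').
Proof.
rewrite !scalerDr scalerN (addrACA (k *: x)) opprD.
by rewrite (addrACA (k *: x + _)).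
Qed.

Fact aplT_term_bilinear_r a b : bilinear_for *:%R *:%R (aplT_term a b).
Proof.
split=> [y|x] k u v; rewrite /aplT_term.
  by rewrite !(linearPr (apl_mul P)) !(tlP, trP) sum3P.
by rewrite commPr !trP sum3P.
Qed.

Fact aplT_term_bilinear_l a' b' :
  bilinear_for *:%R *:%R (fun a b => aplT_term a b a' b').
Proof.
split=> [y|x] k u v; rewrite /aplT_term.
  by rewrite (linearPl (apl_mul P)) !(tlP, trP) sum3P.
by rewrite commPl (linearPl (apl_mul P)) !(trP, tlP) sum3P.
Qed.

Lemma aplT_sum (I : Type) (s : seq I) (a b : I -> A) :
  aplT (\sum_(i <- s) a i \ox b i)
    = \sum_(i <- s) \sum_(j <- s) aplT_term (a i) (b i) (a j) (b j).
Proof.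
rewrite {1}/aplT; set r := (X in tens_lift _ X).
have rE c d : tens_lift (aplT_term c d) r
    = \sum_(j <- s) aplT_term c d (a j) (b j).
  rewrite linear_sum; apply: eq_bigr => j _.
  exact/tens_lift_pure/aplT_term_bilinear_r.
rewrite [LHS]linear_sum; apply: eq_bigr => i _ /=.
rewrite tens_lift_pure ?rE //; split=> [y|x] k u v; rewrite /= !rE.
  rewrite scaler_sumr -big_split; apply: eq_bigr => j _.
  exact: (aplT_term_bilinear_l (a j) (b j)).1.
rewrite scaler_sumr -big_split; apply: eq_bigr => j _.
exact: (aplT_term_bilinear_l (a j) (b j)).2.
Qed.

Definition skew_symmetric (r : tens A A) := tswap r = - r.

Definition APLYBE_solution (r : tens A A) := aplT r = 0.

End APLYBE.

Section OOperator.
Variables (K : fieldType) (A V : vectType K) (P : antiPreLie A).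
Variable M : aplRep P V.

Definition O_operator (T : 'Hom(V, A)) := forall u v : V,
  apl_mul P (T u) (T v) = T (rep_l M (T u) v + rep_r M (T v) u).

End OOperator.

(* sum_k T(v_k) (x) v_k^* in (A (+) V^* ) (x) (A (+) V^* ), which does not    *)
(* depend on the basis (hom_tens_basis).                                     *)
Definition hom_tens (K : fieldType) (A V : vectType K) (T : 'Hom(V, A)) :
    tens (A * dual V)%type (A * dual V)%type :=
  \sum_(k < \dim {:V}) ((T (vbasis {:V})`_k, 0) : (A * dual V)%type)
    \ox ((0, dual_basis (vbasis {:V}) k) : (A * dual V)%type).

Lemma hom_tens_basis (K : fieldType) (A V : vectType K) (T : 'Hom(V, A))
    n (b : n.-tuple V) (b_basis : basis_of {:V} b) :
  hom_tens T = \sum_(k < n) ((T b`_k, 0) : (A * dual V)%type)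
    \ox ((0, dual_basis b k) : (A * dual V)%type).
Proof.
pose e := vbasis {:V}; pose AV := (A * dual V)%type.
have pairD (x y : A) : ((x + y, 0) : AV) = ((x, 0) : AV) + ((y, 0) : AV).
  by congr (_, _); rewrite /= addr0.
have pairD' (f g : dual V) : ((0, f + g) : AV) = ((0, f) : AV) + ((0, g) : AV).
  by congr (_, _); rewrite /= addr0.
have pairZ a (x : A) : ((a *: x, 0) : AV) = a *: ((x, 0) : AV).
  by congr (_, _); rewrite /= scaler0.
have pairZ' a (f : dual V) : ((0, a *: f) : AV) = a *: ((0, f) : AV).
  by congr (_, _); rewrite /= scaler0.
transitivity (\sum_(k < n) \sum_(j < \dim {:V})
    coord e j b`_k *: (((T e`_j, 0) : AV) \ox ((0, dual_basis b k) : AV))).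
  rewrite exchange_big /hom_tens; apply: eq_bigr => j _ /=.
  rewrite -/e; have -> : dual_basis e j
      = \sum_(k < n) coord e j b`_k *: dual_basis b k.
    apply: dualP => v; rewrite dual_sum dual_basisE.
    rewrite [in LHS](coord_basis b_basis (memvf v)) linear_sum.
    apply: eq_bigr => k _; rewrite dualZ dual_basisE linearZ /=.
    exact: mulrC.
  rewrite (big_morph (fun f : dual V => (0, f) : AV) pairD' (erefl _)).
  rewrite linear_sumr; apply: eq_bigr => k _.
  by rewrite pairZ' linearZr_LR.
apply: eq_bigr => k _ /=.
rewrite [b`_k in RHS](coord_vbasis (memvf _)) linear_sum.
rewrite (big_morph (fun x : A => (x, 0) : AV) pairD (erefl _)).
rewrite linear_sumlz; apply: eq_bigr => j _.
by rewrite linearZ pairZ linearZl_LR.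
Qed.

(* Main.v *)
(** Let e_i be a basis of V and d_i its dual basis. Since
  sum_i e_i (x) rho^*(a) d_i = - sum_i rho(a) e_i (x) d_i, the APL-YBE tensor of
  T - tau(T) equals
    sum_ij O_ij (x) d_i (x) d_j - d_i (x) O_ij (x) d_j
      + d_i (x) d_j (x) (O_ji - O_ij),
  where O_ij = T e_i o T e_j - T (l (T e_i) e_j + r (T e_j) e_i). Contracting
  the last two tensor factors with vectors of V recovers O. *)
From HB Require Import structures.
Require Import Defs.
From mathcomp Require Import all_boot all_order all_algebra.
From mathcomp Require Import ring.
Import GRing.Theory.
Local Open Scope ring_scope.

(** * Contraction of the last tensor factor with a linear form *)

Section Contraction.
Set Implicit Arguments.
Variables (K : fieldType) (U W : vectType K) (f : W -> K).
Hypothesis f_linear : forall k x y, f (k *: x + y) = k * f x + f y.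

Definition tcontr : tens U W -> U := tens_lift (fun u w => f w *: u).
HB.instance Definition _ := GRing.Linear.on tcontr.

Lemma tcontr_pure u w : tcontr (u \ox w) = f w *: u.
Proof.
rewrite /tcontr tens_lift_pure //; split=> [y|x] k v v' /=.
  by rewrite scalerDr !scalerA mulrC.
by rewrite f_linear scalerDl scalerA.
Qed.

End Contraction.

(** * Moving a dual action across the canonical element of [V] and its dual *)

Section DualMap.
Set Implicit Arguments.
Variables (K : fieldType) (A V : vectType K) (X : lmodType K).
Variables (rho : A -> 'End(V)) (x : A).

Let e := vbasis {:V}.

(** In the dual basis the matrix of [dual_map rho x] is minus the transpose of that of [rho x], so
    both sides expand to the same double sum over the entries of that matrix. *)
Lemma dual_map_bilinear (F : {bilinear V -> dual V -> X}) :
  \sum_(i < \dim {:V}) F e`_i (dual_map rho x (dual_basis e i))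
    = - \sum_(i < \dim {:V}) F (rho x e`_i) (dual_basis e i).
Proof.
have dualE i : dual_map rho x (dual_basis e i)
    = - \sum_(j < \dim {:V}) coord e i (rho x e`_j) *: dual_basis e j.
  apply: dualP => v; rewrite dual_mapE dualN dual_sum dual_basisE; congr (- _).
  rewrite [in LHS](coord_vbasis (memvf v)) !linear_sum.
  by apply: eq_bigr => j _; rewrite dualZ dual_basisE !linearZ mulrC.
have rhoE (j : 'I_(\dim {:V})) :
    rho x e`_j = \sum_(i < \dim {:V}) coord e i (rho x e`_j) *: e`_i.
  exact: coord_vbasis (memvf _).
under eq_bigr => i _ do rewrite dualE linearNr linear_sumr.
rewrite sumrN exchange_big /=; congr (- _); apply: eq_bigr => j _.
rewrite [in RHS]rhoE linear_sumlz; apply: eq_bigr => i _.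
by rewrite linearZr_LR linearZl_LR.
Qed.

(** The unbundled form applies to explicit functions built from [T] and a tensor slot. *)
Lemma dual_map_vbasis (F : V -> dual V -> X) :
    bilinear_for *:%R *:%R F ->
  \sum_(i < \dim {:V}) F e`_i (dual_map rho x (dual_basis e i))
    = - \sum_(i < \dim {:V}) F (rho x e`_i) (dual_basis e i).
Proof.
move=> F_bilin.
pose B := bilinear_isBilinear.Build K V (dual V) X *:%R *:%R F F_bilin.
pose G : {bilinear V -> dual V -> X} := HB.pack F B.
exact: (dual_map_bilinear G).
Qed.

End DualMap.

(** * The failure of [T] to be an O-operator, as a bilinear map *)

Section Defect.
Set Implicit Arguments.
Variables (K : fieldType) (A V : vectType K) (P : antiPreLie A).
Variables (M : aplRep P V) (T : 'Hom(V, A)).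

Definition O_defect (u v : V) : A :=
  apl_mul P (T u) (T v) - T (rep_l M (T u) v + rep_r M (T v) u).

Lemma O_operatorP : O_operator M T <-> forall u v, O_defect u v = 0.
Proof. by split=> H u v; [rewrite /O_defect H subrr | apply/subr0_eq/H]. Qed.

(** Bilinearity is what lets the values on basis pairs determine the defect everywhere. *)
Lemma O_defect_bilinear : bilinear_for *:%R *:%R O_defect.
Proof.
have regroup k (p q p' q' : V) (a b : A) :
    k *: a + b - T (k *: p + p' + (k *: q + q'))
      = k *: (a - T (p + q)) + (b - T (p' + q')).
  by rewrite addrACA -scalerDr linearP scalerBr opprD addrACA.
split=> [v|u] k x y; rewrite /O_defect.
  rewrite !linearP (linearPl (apl_mul P)) rep_l_linear /=.
  by rewrite add_lfunE scale_lfunE regroup.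
rewrite !linearP rep_r_linear /=.
by rewrite add_lfunE scale_lfunE regroup.
Qed.

End Defect.

(** * The quadratic map [aplT] on a skew-symmetrised sum *)

Section AplTSkew.
Set Implicit Arguments.
Variables (K : fieldType) (A : vectType K) (P : antiPreLie A).
Variables (I : finType) (x y : I -> A).

Let linear_mapN (U W : lmodType K) (h : U -> W) u :
  linear h -> h (- u) = - h u.
Proof.
move/zmod_morphism_linear => hB.
by rewrite -[- u]add0r hB -{1}(subrr 0) hB subrr add0r.
Qed.

Lemma aplT_sum_skew :
  aplT P (\sum_i x i \ox y i - \sum_i y i \ox x i)
    = \sum_i \sum_j
        (aplT_term P (x i) (y i) (x j) (y j)
           - aplT_term P (x i) (y i) (y j) (x j)
         + (aplT_term P (y i) (x i) (y j) (x j)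
             - aplT_term P (y i) (x i) (x j) (y j))).
Proof.
(* Indexing by [I + I], with the sign absorbed in the first factor, turns the difference into one
   sum of pure tensors, to which [aplT_sum] applies. *)
pose a (k : I + I) := match k with inl i => x i | inr i => - y i end.
pose b (k : I + I) := match k with inl i => y i | inr i => x i end.
have -> : \sum_i x i \ox y i - \sum_i y i \ox x i = \sum_k a k \ox b k.
  rewrite big_sumType /= -sumrN; congr (_ + _).
  by apply: eq_bigr => i _; rewrite linearNl.
have termNl p q p' q' : aplT_term P (- p) q p' q' = - aplT_term P p q p' q'.
  exact: (linear_mapN _ ((aplT_term_bilinear_l P p' q').1 q)).
have termNr p q p' q' : aplT_term P p q (- p') q' = - aplT_term P p q p' q'.
  exact: (linear_mapN _ ((aplT_term_bilinear_r P p q).1 q')).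
rewrite aplT_sum big_sumType /= -big_split; apply: eq_bigr => i _.
rewrite !big_sumType /= -!big_split; apply: eq_bigr => j _ /=.
by rewrite !(termNl, termNr) opprK [X in _ = _ + X]addrC.
Qed.

End AplTSkew.

(** * Products and tensors in the semi-direct product *)

Section SemidirectTensor.
Set Implicit Arguments.
Variables (K : fieldType) (A V : vectType K) (P : antiPreLie A).
Variables (M : aplRep P V) (T : 'Hom(V, A)).

Local Notation n := (\dim {:V}).
Local Notation AV := (A * dual V)%type.

Definition inA (x : A) : AV := (x, 0).
Definition inD (f : dual V) : AV := (0, f).

Fact inA_is_linear : linear inA.
Proof. by move=> k x y; congr (_, _); rewrite /= scaler0 addr0. Qed.
HB.instance Definition _ := GRing.isLinear.Build K A AV *:%R inA inA_is_linear.

Fact inD_is_linear : linear inD.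
Proof. by move=> k x y; congr (_, _); rewrite /= scaler0 addr0. Qed.
HB.instance Definition _ :=
  GRing.isLinear.Build K (dual V) AV *:%R inD inD_is_linear.

Let Ahat := semidirect (dualRep M).
Let mul := apl_mul Ahat.

Lemma mulAA x y : mul (inA x) (inA y) = inA (apl_mul P x y).
Proof. by congr (_, _); rewrite /= !linear0 addr0. Qed.

Let linear_map0 (U W : lmodType K) (h : U -> W) : linear h -> h 0 = 0.
Proof. by move/zmod_morphism_linear => hB; rewrite -(subrr 0) hB subrr. Qed.

Lemma mulAD x f : mul (inA x) (inD f) = inD (dual_l M x f).
Proof.
rewrite [LHS]surjective_pairing /=; congr (_, _); rewrite ?linear0r //.
by rewrite (linear_map0 (dual_r_linear M)) zero_lfunE addr0.
Qed.

Lemma mulDA x f : mul (inD f) (inA x) = inD (dual_r M x f).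
Proof.
rewrite [LHS]surjective_pairing /=; congr (_, _); rewrite ?linear0l //.
by rewrite (linear_map0 (dual_l_linear M)) zero_lfunE add0r.
Qed.

Lemma mulDD f g : mul (inD f) (inD g) = 0.
Proof.
rewrite [LHS]surjective_pairing /= linear0l; congr (_, _).
rewrite (linear_map0 (dual_l_linear M)) (linear_map0 (dual_r_linear M)).
by rewrite !zero_lfunE addr0.
Qed.

Let e := vbasis {:V}.
Let d (i : 'I_n) : dual V := dual_basis e i.

Section Flip.
Variables (X : lmodType K) (G : A -> dual V -> dual V -> X).
Variable rho : A -> 'End(V).

(** For each fixed [j] the sum over [i] is an instance of [dual_map_vbasis]; [d j] is a spectator.
    The map [G] stands for any of the three slots that the factor from [A] may occupy. *)
Lemma dual_map_flip_l :
  (forall g, bilinear_for *:%R *:%R (fun x f => G x f g)) ->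
  \sum_(i < n) \sum_(j < n)
      G (T e`_i) (dual_map rho (T e`_j) (d i)) (d j)
    = - \sum_(i < n) \sum_(j < n) G (T (rho (T e`_j) e`_i)) (d i) (d j).
Proof.
move=> G_bilin; rewrite exchange_big [in RHS]exchange_big -sumrN /=.
apply: eq_bigr => j _.
apply: (@dual_map_vbasis _ _ _ _ rho _ (fun v f => G (T v) f (d j))).
split=> [f|v] k x y; rewrite ?linearP; first exact: (G_bilin _).1.
exact: (G_bilin _).2.
Qed.

Lemma dual_map_flip_r :
  (forall f, bilinear_for *:%R *:%R (fun x g => G x f g)) ->
  \sum_(i < n) \sum_(j < n)
      G (T e`_j) (d i) (dual_map rho (T e`_i) (d j))
    = - \sum_(i < n) \sum_(j < n) G (T (rho (T e`_i) e`_j)) (d i) (d j).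
Proof.
move=> G_bilin; rewrite -sumrN /=; apply: eq_bigr => i _.
apply: (@dual_map_vbasis _ _ _ _ rho _ (fun v g => G (T v) (d i) g)).
split=> [f|v] k x y; rewrite ?linearP; first exact: (G_bilin _).1.
exact: (G_bilin _).2.
Qed.

End Flip.

(** The letters record which slot holds the element of [A]. The covectors come first as arguments,
    so that [tADD f g] is a linear map on [A]; likewise for the other two. *)
Definition tADD (f g : dual V) (x : A) := inA x \ox inD f \ox inD g.
Definition tDAD (f g : dual V) (x : A) := inD f \ox inA x \ox inD g.
Definition tDDA (f g : dual V) (x : A) := inD f \ox inD g \ox inA x.

Fact tADD_bilinear_l g : bilinear_for *:%R *:%R (fun x f => tADD f g x).
Proof.
by split=> [f|v] k x y; rewrite /tADD !(linearPl, linearPr, linearP).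
Qed.
Fact tADD_bilinear_r f : bilinear_for *:%R *:%R (fun x g => tADD f g x).
Proof.
by split=> [g|v] k x y; rewrite /tADD !(linearPl, linearPr, linearP).
Qed.
Fact tDAD_bilinear_l g : bilinear_for *:%R *:%R (fun x f => tDAD f g x).
Proof.
by split=> [f|v] k x y; rewrite /tDAD !(linearPl, linearPr, linearP).
Qed.
Fact tDAD_bilinear_r f : bilinear_for *:%R *:%R (fun x g => tDAD f g x).
Proof.
by split=> [g|v] k x y; rewrite /tDAD !(linearPl, linearPr, linearP).
Qed.
Fact tDDA_bilinear_l g : bilinear_for *:%R *:%R (fun x f => tDDA f g x).
Proof.
by split=> [f|v] k x y; rewrite /tDDA !(linearPl, linearPr, linearP).
Qed.
Fact tDDA_bilinear_r f : bilinear_for *:%R *:%R (fun x g => tDDA f g x).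
Proof.
by split=> [g|v] k x y; rewrite /tDDA !(linearPl, linearPr, linearP).
Qed.

Fact tADD_linear f g : linear (tADD f g).
Proof. exact: (tADD_bilinear_l g).1. Qed.
HB.instance Definition _ f g :=
  GRing.isLinear.Build K _ _ _ (tADD f g) (tADD_linear f g).
Fact tDAD_linear f g : linear (tDAD f g).
Proof. exact: (tDAD_bilinear_l g).1. Qed.
HB.instance Definition _ f g :=
  GRing.isLinear.Build K _ _ _ (tDAD f g) (tDAD_linear f g).
Fact tDDA_linear f g : linear (tDDA f g).
Proof. exact: (tDDA_bilinear_l g).1. Qed.
HB.instance Definition _ f g :=
  GRing.isLinear.Build K _ _ _ (tDDA f g) (tDDA_linear f g).

(** * The APL-YBE tensor of [T] minus its swap *)

Let O := O_defect M T.

Lemma dual_lD x f :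
  dual_l M x f = dual_map (rep_r M) x f - dual_map (rep_l M) x f.
Proof. by rewrite add_lfunE opp_lfunE. Qed.

(** The left action is $r^*-l^*$ and the right one $r^*$, so the $r^*$ parts cancel in the
    commutator. *)
Lemma commDA x f :
  apl_comm Ahat (inD f) (inA x) = inD (dual_map (rep_l M) x f).
Proof.
by rewrite /apl_comm mulDA mulAD -linearB dual_lD opprB addrC subrK.
Qed.

(** The suffix gives the types of the four arguments. In this lemma and the next three, a summand of
    [aplT_term] drops out exactly when it multiplies two covectors. *)
Lemma term_ADAD x y f g : aplT_term Ahat (inA x) (inD f) (inA y) (inD g)
  = tADD f g (apl_mul P x y) + tADD (dual_map (rep_r M) y f) g x.
Proof.
by rewrite /aplT_term /apl_comm !mulDD mulDA mulAA subrr linear0r subr0.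
Qed.

Lemma term_ADDA x y f g : aplT_term Ahat (inA x) (inD f) (inD g) (inA y)
  = tDDA (dual_map (rep_r M) x g) f y - tDDA (dual_map (rep_l M) x g) f y
    - tADD g (dual_map (rep_l M) y f) x.
Proof.
rewrite /aplT_term commDA mulAD mulDD linear0r linear0l addr0 dual_lD.
by rewrite linearB !linearBl.
Qed.

Lemma term_DAAD x y f g : aplT_term Ahat (inD f) (inA x) (inA y) (inD g)
  = tDAD (dual_map (rep_r M) y f) g x + tDAD f g (apl_mul P x y)
    + tDAD f (dual_map (rep_l M) x g) y.
Proof.
rewrite /aplT_term /apl_comm -[apl_mul _ (inA x) _ - _]opprB.
rewrite -/(apl_comm Ahat (inD g) (inA x)) commDA mulDA mulAA.
by rewrite linearNr opprK.
Qed.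

Lemma term_DADA x y f g : aplT_term Ahat (inD f) (inA x) (inD g) (inA y)
  = tDDA f (dual_map (rep_r M) x g) y - tDDA f (dual_map (rep_l M) x g) y
    - tDDA f g (apl_mul P x y - apl_mul P y x).
Proof.
rewrite /aplT_term /apl_comm mulDD mulAD !mulAA !linear0l add0r dual_lD.
by rewrite -linearB [inD (_ - _)]linearB linearBr linearBl.
Qed.

Lemma aplT_hom_tens :
  aplT Ahat (hom_tens T - tswap (hom_tens T))
    = \sum_(i < n) \sum_(j < n)
        (tADD (d i) (d j) (O e`_i e`_j) - tDAD (d i) (d j) (O e`_i e`_j)
          + tDDA (d i) (d j) (O e`_j e`_i - O e`_i e`_j)).
Proof.
pose tAAA := tens (tens AV AV) AV.
(* Whole double sums are manipulated, since the flips below hold only after summation. *)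
pose S (F : 'I_n -> 'I_n -> tAAA) := \sum_i \sum_j F i j.
have SD F G : S F + S G = S (fun i j => F i j + G i j).
  by rewrite -big_split; apply: eq_bigr => i _; rewrite -big_split.
have SN F : - S F = S (fun i j => - F i j).
  by rewrite -sumrN; apply: eq_bigr => i _; rewrite -sumrN.
have SC F : S F = S (fun i j => F j i) by rewrite /S exchange_big.
pose l := rep_l M; pose r := rep_r M.
have pADr : S (fun i j => tADD (dual_map r (T e`_j) (d i)) (d j) (T e`_i))
    = - S (fun i j => tADD (d i) (d j) (T (r (T e`_j) e`_i))).
  exact: (@dual_map_flip_l _ (fun x f g => tADD f g x) _ tADD_bilinear_l).
have pADl : S (fun i j => tADD (d j) (dual_map l (T e`_j) (d i)) (T e`_i))
    = - S (fun i j => tADD (d i) (d j) (T (l (T e`_i) e`_j))).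
  (* Exchanging the two indices brings the sum to the shape of the flip lemma. *)
  rewrite SC.
  exact: (@dual_map_flip_r _ (fun x f g => tADD f g x) _ tADD_bilinear_r).
have pDAr : S (fun i j => tDAD (dual_map r (T e`_j) (d i)) (d j) (T e`_i))
    = - S (fun i j => tDAD (d i) (d j) (T (r (T e`_j) e`_i))).
  exact: (@dual_map_flip_l _ (fun x f g => tDAD f g x) _ tDAD_bilinear_l).
have pDAl : S (fun i j => tDAD (d i) (dual_map l (T e`_i) (d j)) (T e`_j))
    = - S (fun i j => tDAD (d i) (d j) (T (l (T e`_i) e`_j))).
  exact: (@dual_map_flip_r _ (fun x f g => tDAD f g x) _ tDAD_bilinear_r).
have pDDl rho : S (fun i j => tDDA (dual_map rho (T e`_i) (d j)) (d i) (T e`_j))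
    = - S (fun i j => tDDA (d i) (d j) (T (rho (T e`_j) e`_i))).
  rewrite SC.
  exact: (@dual_map_flip_l _ (fun x f g => tDDA f g x) _ tDDA_bilinear_l).
have pDDr rho : S (fun i j => tDDA (d i) (dual_map rho (T e`_i) (d j)) (T e`_j))
    = - S (fun i j => tDDA (d i) (d j) (T (rho (T e`_i) e`_j))).
  exact: (@dual_map_flip_r _ (fun x f g => tDDA f g x) _ tDDA_bilinear_r).
have -> : tswap (hom_tens T)
    = \sum_(k < n) inD (d k) \ox inA (T e`_k).
  rewrite /tswap linear_sum; apply: eq_bigr => k _; exact: tswap_pure.
rewrite [LHS](@aplT_sum_skew _ _ _ _
  (fun k : 'I_n => inA (T e`_k)) (fun k => inD (d k))).
pose TT i j := apl_mul P (T e`_i) (T e`_j).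
(* One double sum per elementary tensor, so that each can be flipped separately. After the flips
   every dual action has moved inside [T], and the identity holds term by term. *)
transitivity (S (fun i j => tADD (d i) (d j) (TT i j))
  + S (fun i j => tADD (dual_map r (T e`_j) (d i)) (d j) (T e`_i))
  - (S (fun i j => tDDA (dual_map r (T e`_i) (d j)) (d i) (T e`_j))
     - S (fun i j => tDDA (dual_map l (T e`_i) (d j)) (d i) (T e`_j))
     - S (fun i j => tADD (d j) (dual_map l (T e`_j) (d i)) (T e`_i)))
  + (S (fun i j => tDDA (d i) (dual_map r (T e`_i) (d j)) (T e`_j))
     - S (fun i j => tDDA (d i) (dual_map l (T e`_i) (d j)) (T e`_j))
     - S (fun i j => tDDA (d i) (d j) (TT i j - TT j i))
     - (S (fun i j => tDAD (dual_map r (T e`_j) (d i)) (d j) (T e`_i))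
        + S (fun i j => tDAD (d i) (d j) (TT i j))
        + S (fun i j => tDAD (d i) (dual_map l (T e`_i) (d j)) (T e`_j))))).
  rewrite !(SN, SD); apply: eq_bigr => i _; apply: eq_bigr => j _.
  by rewrite term_ADAD term_ADDA term_DADA term_DAAD.
rewrite pADr pADl pDAr pDAl !pDDl !pDDr !(SN, SD).
apply: eq_bigr => i _; apply: eq_bigr => j _.
have OE (F : {linear A -> tAAA}) p q : F (O e`_p e`_q)
    = F (TT p q) - (F (T (l (T e`_p) e`_q)) + F (T (r (T e`_q) e`_p))).
  by rewrite linearB !linearD.
rewrite ![tDDA _ _ (_ - _)]linearB !OE /=.
(* The letters [a], [b], [c] stand for the [tADD], [tDAD], [tDDA] tensors. This identity of abelian
   groups is checked on matrix entries, where [ring] applies. *)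
have cancel (a1 a2 a3 b1 b2 b3 c1 c2 c3 c4 c5 c6 : tAAA) :
    a1 - a2 - (- c3 - - c4 - - a3)
      + (- c6 - - c5 - (c1 - c2) - (- b2 + b1 - b3))
    = a1 - (a3 + a2) - (b1 - (b3 + b2))
      + (c2 - (c4 + c6) - (c1 - (c5 + c3))).
  by apply/matrixP=> p q; rewrite !mxE; ring.
exact: cancel.
Qed.

(** * Recovering the defect by evaluation at vectors of [V] *)

Let ev (u : V) (p : AV) : K := p.2 u.

Let ev_linear u k p q : ev u (k *: p + q) = k * ev u p + ev u q.
Proof. by rewrite /ev /= dualD dualZ. Qed.

(** The form [ev] kills [A], so of the three kinds of tensors only [tADD], with covectors in both
    contracted slots, can survive. *)
Definition contr_dual (u v : V) (t : tens (tens AV AV) AV) : A :=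
  (tcontr (ev u) (tcontr (ev v) t)).1.

Fact contr_dual_is_linear u v : linear (contr_dual u v).
Proof. by move=> k s t; rewrite /contr_dual !linearP. Qed.
HB.instance Definition _ u v :=
  GRing.isLinear.Build K _ _ _ (contr_dual u v) (contr_dual_is_linear u v).

Let contr_dual_pure u v p q s :
  contr_dual u v (p \ox q \ox s) = (ev v s * ev u q) *: p.1.
Proof.
rewrite /contr_dual (@tcontr_pure _ _ _ _ (ev_linear v)) linearZ /=.
by rewrite (@tcontr_pure _ _ _ _ (ev_linear u)) /= scalerA.
Qed.

Let ev_inA u x : ev u (inA x) = 0.
Proof. by rewrite /ev /= -(scale0r (0 : dual V)) dualZ mul0r. Qed.

Lemma contr_tADD u v f g x : contr_dual u v (tADD f g x) = (f u * g v) *: x.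
Proof. by rewrite contr_dual_pure mulrC. Qed.

Lemma contr_tDAD u v f g x : contr_dual u v (tDAD f g x) = 0.
Proof. by rewrite contr_dual_pure ev_inA mulr0 scale0r. Qed.

Lemma contr_tDDA u v f g x : contr_dual u v (tDDA f g x) = 0.
Proof. by rewrite contr_dual_pure ev_inA mul0r scale0r. Qed.

Lemma contr_aplT_hom_tens u v :
  contr_dual u v (aplT Ahat (hom_tens T - tswap (hom_tens T)))
    = O_defect M T u v.
Proof.
(* As a [tens_lift] at [u \ox v], the defect expands over basis pairs with the coordinates of [u]
   and [v] as coefficients. These are the values of the dual basis produced by [contr_tADD]. *)
rewrite -(tens_lift_pure (O_defect_bilinear M T)) /tens_lift aplT_hom_tens.
rewrite linear_sum; apply: eq_bigr => i _; rewrite linear_sum.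
apply: eq_bigr => j _; rewrite linearD linearB /= contr_tADD contr_tDAD.
by rewrite contr_tDDA subr0 addr0 mxE /d !dual_basisE.
Qed.

End SemidirectTensor.

(** * The swap as a linear involution *)

Section Swap.
Variable K : fieldType.

HB.instance Definition _ (U W : vectType K) :=
  GRing.isLinear.Build K (tens U W) (tens W U) *:%R (@tswap K U W)
    (tens_lift_is_linear (fun u w => w \ox u)).

(** Two linear maps that agree on pure tensors are equal. *)
Lemma tswapK (U W : vectType K) : cancel (@tswap K U W) (@tswap K W U).
Proof.
move=> t; pose g : {linear _ -> _} := @tswap K W U \o @tswap K U W.
pose h : {linear tens U W -> tens U W} := idfun.
apply: (@tens_lift_uniq K U W _ g h) => u w.
by rewrite /= !tswap_pure.
Qed.

End Swap.

Theorem theorem2p26 (K : closedFieldType) (charK : [pchar K] =i pred0)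
    (A V : vectType K) (P : antiPreLie A) (M : aplRep P V) (T : 'Hom(V, A)) :
  let r := hom_tens T - tswap (hom_tens T) in
  skew_symmetric r /\ APLYBE_solution (semidirect (dualRep M)) r
    <-> O_operator M T.
Proof.
move=> r; split=> [[_ r0] | /O_operatorP O0].
  by apply/O_operatorP => u v; rewrite -contr_aplT_hom_tens r0 linear0.
(* Skew-symmetry holds for every [T], because the swap is an involution. *)
split; first by rewrite /skew_symmetric linearB /= tswapK opprB.
rewrite /APLYBE_solution aplT_hom_tens big1 // => i _; rewrite big1 // => j _.
by rewrite !O0 subrr !linear0 !addr0.
Qed.
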